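(* Let $G$ be a finitely generated group hyperbolic relative to a collection of subgroups $\{H_1,\ldots,H_m\}$. If $R$ is a strongly relatively quasi-convex subgroup of $G$, then $R$ is a hyperbolic group.
   Context: Relative hyperbolicity. Let $X$ be a finite set generating $G$ relative to $\{H_1,\dots,H_m\}$, i.e. $G$ is generated by $X\cup H_1\cup\dots\cup H_m$. Put $F=\widetilde H_1\ast\dots\ast\widetilde H_m\ast F(X)$, where $\widetilde H_i$ is an isomorphic copy of $H_i$ and $F(X)$ is free with basis $X$, and $\mathcal H=\bigsqcup_i(\widetilde H_i\setminus\{1\})$. $G$ has a finite relative presentation $\langle X,H_1,\dots,H_m\mid R=1,R\in\mathcal R\rangle$ if $\mathcal R$ is a finite set of words over $X^{\pm1}\cup\mathcal H$ (closed under cyclic shifts and inverses) whose normal closure in $F$ is the kernel of the canonical epimorphism $F\to G$. Its relative Dehn function is the smallest function $f$ such that every word $W$ over $X^{\pm1}\cup\mathcal H$ of length at most $n$ representing $1$ in $G$ equals in $F$ a product $\prod_{i=1}^kf_i^{-1}R_if_i$ with $R_i\in\mathcal R$, $f_i\in F$, $k\le f(n)$. $G$ is hyperbolic relative to $\{H_1,\dots,H_m\}$ if it has a finite relative presentation whose relative Dehn function is bounded from above by $Ln$ for some constant $L$. Quasi-convexity. Let $X$ be a finite generating set of $G$ in the ordinary sense, $dist_X$ the word metric on $G$ with respect to $X$, and $\Gamma(G,X\cup\mathcal H)$ the Cayley graph of $G$ with respect to the generating set $X\cup H_1\cup\dots\cup H_m$, with edges of length $1$. A subgroup $R\le G$ is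 relatively quasi-convex with respect to $\{H_1,\dots,H_m\}$ if there is a constant $\sigma>0$ such that for any $f,g\in R$, any geodesic path $p$ from $f$ to $g$ in $\Gamma(G,X\cup\mathcal H)$, and any vertex $v\in p$ there is $w\in R$ with $dist_X(v,w)\le\sigma$ (for relatively hyperbolic $G$ this does not depend on the choice of $X$). It is strongly relatively quasi-convex if, in addition, $R\cap H_i^g$ is finite for all $i=1,\dots,m$ and $g\in G$, where $H_i^g=g^{-1}H_ig$. A group is hyperbolic if it is finitely generated and its Cayley graph with respect to a finite generating set is a Gromov hyperbolic metric space. *)

(* Defs.v *)
From HB Require Import structures.
From mathcomp Require Import all_boot all_order all_algebra generic_quotient.
From mathcomp Require Import boolp classical_sets cardinality reals.

Set Implicit Arguments.
Unset Strict Implicit.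
Unset Printing Implicit Defensive.

Import Order.TTheory GRing.Theory Num.Theory.

Local Open Scope quotient_scope.
Local Open Scope classical_set_scope.
Local Open Scope group_scope.

(* A subgroup R of G is a [groupClosed G] (a boolean predicate: classically no
   restriction); [subgroup_type R] is R as a group in its own right. *)
Section SubgroupType.
Variables (G : groupType) (R : groupClosed G).

Definition subgroup_type : Type := {x : G | x \in R}.

HB.instance Definition _ := SubChoice.copy subgroup_type {x : G | x \in R}.

Fact subgroup_type_closed : group_closed (mem R).
Proof. by split; [exact: gpred1 | exact: gpredF]. Qed.

HB.instance Definition _ := SubChoice_isSubGroup.Build G (mem R)
  subgroup_type subgroup_type_closed.

End SubgroupType.

Section WordMetric.
Variable G : groupType.
Implicit Types (S : set G) (g x y : G) (w : seq G).

Definition sym_set S : set G := S `|` [set g^-1 | g in S].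

Definition spells S w g : Prop :=
  (forall s, s \in w -> sym_set S s) /\ \prod_(s <- w) s = g.

Definition generates S : Prop := forall g, exists w, spells S w g.

Definition is_word_length S g (n : nat) : Prop :=
  (exists2 w, spells S w g & size w = n) /\
  (forall w, spells S w g -> (n <= size w)%N).

(* Meaningful when S generates G (the value is 0 for g outside the subgroup
   generated by S). *)
Definition word_length S g : nat := xget 0%N [set n | is_word_length S g n].

Lemma word_lengthP S g : generates S -> is_word_length S g (word_length S g).
Proof.
move=> genS; rewrite /word_length; case: xgetP => [n _ //|noS].
have exn : exists n, `[< exists2 w, spells S w g & size w = n >].
  by have [w Sw] := genS g; exists (size w); apply/asboolP; exists w.
case: (ex_minnP exn) => n /asboolP[w Sw sz_w] min_n.
case: (noS n); split; first by exists w.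
by move=> v Sv; apply/min_n/asboolP; exists v.
Qed.

Definition word_dist S x y : nat := word_length S (x^-1 * y).

(* Combinatorial paths of the Cayley graph of G with respect to S, given by
   their first vertex and the sequence of the following ones. *)
Definition cayley_adj S : rel G := fun x y => `[< sym_set S (x^-1 * y) >].

Definition cayley_path S x y (p : seq G) : Prop :=
  path (cayley_adj S) x p /\ last x p = y.

Definition cayley_geodesic S x y (p : seq G) : Prop :=
  cayley_path S x y p /\
  forall q, cayley_path S x y q -> (size p <= size q)%N.

End WordMetric.

(* The Cayley graph as a metric space, with edges isometric to [0, 1]: besides
   the vertices there are, for x in G, s in S and 0 < t < 1, the points at
   distance t from x on the edge joining x to x * s. *)
Section CayleySpace.
Variables (K : realType) (G : groupType) (S : set G).

Inductive cayley_point :=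
  | CVertex of G
  | CEdge (x s : G) (t : K) of S s & (0 < t < 1)%R.

Definition vertex_dist (x : G) (p : cayley_point) : K :=
  match p with
  | CVertex y => ((word_dist S x y)%:R)%R
  | CEdge y s t _ _ =>
      Num.min ((word_dist S x y)%:R + t) ((word_dist S x (y * s))%:R + (1 - t))
  end%R.

Definition cayley_dist (p q : cayley_point) : K :=
  match p with
  | CVertex x => vertex_dist x q
  | CEdge x s t _ _ =>
      let d := Num.min (t + vertex_dist x q) (1 - t + vertex_dist (x * s)%g q) in
      match q with
      | CVertex _ => d
      | CEdge y r u _ _ =>
          (* two points of one edge may also be joined inside this edge *)
          if (x == y) && (s == r) then Num.min `|t - u| d else d
      end
  end%R.

End CayleySpace.

Section Hyperbolic.
Variable K : realType.
Local Open Scope ring_scope.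

Definition gromov_product (M : Type) (d : M -> M -> K) (w x y : M) : K :=
  (d x w + d y w - d x y) / 2.

Definition gromov_hyperbolic (M : Type) (d : M -> M -> K) : Prop :=
  exists delta : K, forall w x y z : M,
    Num.min (gromov_product d w x y) (gromov_product d w y z) - delta
      <= gromov_product d w x z.

Definition hyperbolic_group (G : groupType) : Prop :=
  exists S : set G, [/\ finite_set S, generates S &
    gromov_hyperbolic (@cayley_dist K G S)].

End Hyperbolic.

(* Words over the letters x, x^-1 (x in X) and h in H_i~ (i < m); [inl (x, e)]
   is x if e = false and x^-1 if e = true.  The letters from distinct H_i~ are
   distinct, and distinct from those of X.  Trivial elements of the H_i~ are
   letters here; words over X^{+-1} u \mathcal{H} are singled out by
   [XH_word]. *)
Section FreeProduct.
Variables (G : groupType) (X : set G) (m : nat) (H : 'I_m -> groupClosed G).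

Definition letter : Type := (X * bool) + {i : 'I_m & subgroup_type (H i)}.

HB.instance Definition _ := Choice.copy letter
  ((X * bool) + {i : 'I_m & subgroup_type (H i)})%type.

Definition X_letter (x : X) (e : bool) : letter := inl (x, e).
Definition H_letter (i : 'I_m) (h : subgroup_type (H i)) : letter :=
  inr (existT _ i h).

Definition letter_inv (a : letter) : letter :=
  match a with
  | inl (x, e) => X_letter x (~~ e)
  | inr (existT i h) => H_letter h^-1
  end.

Definition letter_val (a : letter) : G :=
  match a with
  | inl (x, e) => if e then (\val x)^-1 else \val x
  | inr (existT i h) => \val h
  end.

Definition letter_nontrivial (a : letter) : bool :=
  match a with inl _ => true | inr (existT i h) => h != 1 end.

Definition XH_word : pred (seq letter) := all letter_nontrivial.

Definition word_inv (w : seq letter) : seq letter := rev (map letter_inv w).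

Definition word_val (w : seq letter) : G := \prod_(a <- w) letter_val a.

(* The free product F = H_1~ * ... * H_m~ * F(X), as the group of all words
   modulo the congruence generated by the relations x x^-1 = x^-1 x = 1 and
   the multiplication tables of the H_i~. *)
Inductive free_eq : seq letter -> seq letter -> Prop :=
  | free_eq_refl u : free_eq u u
  | free_eq_sym u v : free_eq u v -> free_eq v u
  | free_eq_trans v u w : free_eq u v -> free_eq v w -> free_eq u w
  | free_eq_cat u u' v v' :
      free_eq u u' -> free_eq v v' -> free_eq (u ++ v) (u' ++ v')
  | free_eq_X x e : free_eq [:: X_letter x e; X_letter x (~~ e)] [::]
  | free_eq_H1 i : free_eq [:: H_letter (1 : subgroup_type (H i))] [::]
  | free_eq_HM i (h k : subgroup_type (H i)) :
      free_eq [:: H_letter h; H_letter k] [:: H_letter (h * k)].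

Definition free_eqb : rel (seq letter) := fun u v => `[< free_eq u v >].

Fact free_eqb_refl : reflexive free_eqb.
Proof. by move=> u; apply/asboolP/free_eq_refl. Qed.

Fact free_eqb_sym : symmetric free_eqb.
Proof.
by move=> u v; apply/asboolP/asboolP => /free_eq_sym.
Qed.

Fact free_eqb_trans : transitive free_eqb.
Proof.
by move=> v u w /asboolP uv /asboolP vw; apply/asboolP/(free_eq_trans uv vw).
Qed.

Canonical free_equiv := EquivRel free_eqb free_eqb_refl free_eqb_sym
  free_eqb_trans.

Definition free_product : Type := {eq_quot free_equiv}.

HB.instance Definition _ := Choice.copy free_product {eq_quot free_equiv}.

Definition free_class (w : seq letter) : free_product :=
  \pi_({eq_quot free_equiv}) w.
Definition free_repr (x : free_product) : seq letter :=
  repr (x : {eq_quot free_equiv}).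

Lemma free_reprK : cancel free_repr free_class.
Proof. exact: reprK. Qed.

Lemma free_classP u v : free_class u = free_class v <-> free_eq u v.
Proof.
rewrite /free_class; split=> [/eqP|uv]; first by rewrite eqmodE => /asboolP.
by apply/eqP; rewrite eqmodE; apply/asboolP.
Qed.

Lemma free_class_repr w : free_eq (free_repr (free_class w)) w.
Proof. by apply/free_classP; rewrite free_reprK. Qed.

Lemma word_inv_cat u v : word_inv (u ++ v) = word_inv v ++ word_inv u.
Proof. by rewrite /word_inv map_cat rev_cat. Qed.

Lemma letter_invK : involutive letter_inv.
Proof. by case=> [[x e]|[i h]] /=; rewrite ?negbK // /H_letter invgK. Qed.

Lemma word_invK : involutive word_inv.
Proof. by move=> w; rewrite /word_inv map_rev revK mapK //; exact: letter_invK. Qed.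

Lemma free_eq_letter_inv a : free_eq [:: a; letter_inv a] [::].
Proof.
case: a => [[x e]|[i h]] /=; first exact: free_eq_X.
apply: (free_eq_trans (free_eq_HM _ _)); rewrite mulgV.
exact: free_eq_H1.
Qed.

Lemma free_eq_mulV w : free_eq (w ++ word_inv w) [::].
Proof.
elim: w => [|a w IHw]; first exact: free_eq_refl.
rewrite -cat1s word_inv_cat -catA (catA w).
apply: free_eq_trans (free_eq_letter_inv a).
rewrite -(cat1s a [:: letter_inv a]); apply: free_eq_cat; first exact: free_eq_refl.
rewrite -[X in free_eq _ X]cat0s; apply: free_eq_cat => //; exact: free_eq_refl.
Qed.

Lemma free_eq_mulVl w : free_eq (word_inv w ++ w) [::].
Proof. by rewrite -[X in _ ++ X]word_invK; exact: free_eq_mulV. Qed.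

Lemma free_eq_inv u v : free_eq u v -> free_eq (word_inv u) (word_inv v).
Proof.
move=> uv; apply: (@free_eq_trans (word_inv u ++ v ++ word_inv v)).
  rewrite -[X in free_eq X _]cats0; apply: free_eq_cat.
    exact: free_eq_refl.
  exact/free_eq_sym/free_eq_mulV.
rewrite catA -[X in free_eq _ X]cat0s; apply: free_eq_cat.
  apply: free_eq_trans (free_eq_mulVl u).
  by apply: free_eq_cat; [exact: free_eq_refl | exact: free_eq_sym].
exact: free_eq_refl.
Qed.

Definition free_one : free_product := free_class [::].
Definition free_mul (x y : free_product) : free_product :=
  free_class (free_repr x ++ free_repr y).
Definition free_inv (x : free_product) : free_product :=
  free_class (word_inv (free_repr x)).

Lemma free_mulE u v : free_mul (free_class u) (free_class v) = free_class (u ++ v).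
Proof. by apply/free_classP/free_eq_cat; exact: free_class_repr. Qed.

Lemma free_invE u : free_inv (free_class u) = free_class (word_inv u).
Proof. by apply/free_classP/free_eq_inv; exact: free_class_repr. Qed.

Fact free_mulA : associative free_mul.
Proof.
move=> x y z; rewrite -(free_reprK x) -(free_reprK y) -(free_reprK z).
by rewrite !free_mulE catA.
Qed.

Fact free_mul1 : left_id free_one free_mul.
Proof. by move=> x; rewrite -(free_reprK x) free_mulE. Qed.

Fact free_1mul : right_id free_one free_mul.
Proof. by move=> x; rewrite -(free_reprK x) free_mulE cats0. Qed.

Fact free_Vmul : left_inverse free_one free_inv free_mul.
Proof.
move=> x; rewrite -(free_reprK x) free_invE free_mulE.
exact/free_classP/free_eq_mulVl.
Qed.

Fact free_mulV : right_inverse free_one free_inv free_mul.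
Proof.
move=> x; rewrite -(free_reprK x) free_invE free_mulE.
exact/free_classP/free_eq_mulV.
Qed.

HB.instance Definition _ := isGroup.Build free_product
  free_mulA free_mul1 free_1mul free_Vmul free_mulV.

(* The canonical homomorphism from F to G. *)
Definition free_to_group (x : free_product) : G := word_val (free_repr x).

Lemma word_val_cat u v : word_val (u ++ v) = word_val u * word_val v.
Proof. exact: big_cat. Qed.

Lemma free_eq_val u v : free_eq u v -> word_val u = word_val v.
Proof.
elim=> {u v} //.
- by move=> v u w _ -> _ ->.
- by move=> u u' v v' _ eq_u _ eq_v; rewrite !word_val_cat eq_u eq_v.
- by move=> x [] /=; rewrite /word_val !big_cons big_nil /= mulg1 ?mulVg ?mulgV.
- by move=> i; rewrite /word_val big_cons !big_nil mulg1.
- by move=> i h k; rewrite /word_val !big_cons !big_nil /= !mulg1.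
Qed.

Lemma free_to_groupE w : free_to_group (free_class w) = word_val w.
Proof. exact/free_eq_val/free_class_repr. Qed.

Fact free_to_group_morphism : monoid.monoid_morphism free_to_group.
Proof.
split=> [|x y]; first by rewrite free_to_groupE /word_val big_nil.
by rewrite free_to_groupE word_val_cat.
Qed.

HB.instance Definition _ := isUMagmaMorphism.Build free_product G
  free_to_group free_to_group_morphism.

End FreeProduct.

Definition normal_closure (F : groupType) (A : set F) : set F :=
  [set x | forall N : groupClosed F,
     (forall n f, n \in N -> n ^ f \in N) -> A `<=` [set` N] -> x \in N].

Definition is_conjugate_product (F : groupType) (A : set F) (k : nat) (x : F) :
    Prop :=
  exists f r : 'I_k -> F,
    (forall i, A (r i)) /\ x = \prod_(i < k) ((f i)^-1 * r i * f i).

Section RelativeHyperbolicity.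
Variables (G : groupType) (m : nat) (H : 'I_m -> groupClosed G).

Definition rel_generating_set (X : set G) : set G :=
  X `|` \bigcup_(i in [set: 'I_m]) [set` H i].

Definition finite_rel_presentation (X : set G) (Rel : set (seq (letter X H))) :
    Prop :=
  [/\ finite_set Rel,
      forall w, Rel w -> XH_word w,
      forall w k, Rel w -> Rel (rot k w),
      forall w, Rel w -> Rel (word_inv w) &
      normal_closure (@free_class _ X m H @` Rel) =
        [set x : free_product X H | free_to_group x = 1]].

Definition rel_isoperimetric (X : set G) (Rel : set (seq (letter X H)))
    (f : nat -> nat) : Prop :=
  forall n (w : seq (letter X H)),
    XH_word w -> (size w <= n)%N -> word_val w = 1 ->
    exists2 k, (k <= f n)%N &
      is_conjugate_product (@free_class _ X m H @` Rel) k (free_class w).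

Definition rel_dehn_function (X : set G) (Rel : set (seq (letter X H)))
    (f : nat -> nat) : Prop :=
  rel_isoperimetric Rel f /\
  forall f', rel_isoperimetric Rel f' -> forall n, (f n <= f' n)%N.

Definition relatively_hyperbolic (K : realType) : Prop :=
  exists (X : set G) (Rel : set (seq (letter X H))),
    [/\ finite_set X, generates (rel_generating_set X),
        finite_rel_presentation Rel &
        exists f, rel_dehn_function Rel f /\
          exists L : K, forall n, ((f n)%:R <= L * n%:R)%R].

Definition rel_quasiconvex (K : realType) (X : set G) (R : groupClosed G) :
    Prop :=
  exists2 sigma : K, (0 < sigma)%R &
    forall f g, f \in R -> g \in R ->
    forall p, cayley_geodesic (rel_generating_set X) f g p ->
    forall v, v \in f :: p ->
    exists2 w, w \in R & ((word_dist X v w)%:R <= sigma)%R.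

Definition strongly_rel_quasiconvex (K : realType) (X : set G)
    (R : groupClosed G) : Prop :=
  rel_quasiconvex K X R /\
  forall (i : 'I_m) (g : G),
    finite_set ([set` R] `&` [set h ^ g | h in [set` H i]]).

End RelativeHyperbolicity.

(* Main.v *)
(* For 1-Lipschitz functions psi and f on the vertices of the coned-off Cayley
   graph, the integral of psi df vanishes along the relations of the H_i and is
   bounded along the relators, so a linear relative Dehn function yields
   |\oint psi df| <= C |loop| for all loops.
   Quasi-convexity and the finiteness of the R n H_i^g provide a finite
   generating set Y of R whose word length is at most linear in the relative
   length; extending Lipschitz functions from R to G, the loop inequality holds
   in the Cayley graph of R with respect to Y.  In any graph, the inequality for
   psi a tent function and f a distance function gives the Morse lemma: a
   geodesic stays near each quasi-geodesic with the same endpoints.  Applied to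
   the quasi-geodesics formed by projecting a point to a geodesic, it gives the
   four-point condition. *)
Require Import Defs.
From mathcomp Require Import all_boot all_order all_algebra.
From mathcomp Require Import boolp classical_sets cardinality reals.
From mathcomp Require Import zify ring lra.

Set Implicit Arguments.
Unset Strict Implicit.
Unset Printing Implicit Defensive.

Import Order.TTheory GRing.Theory Num.Theory.

Ltac ilia := intros; lia.
Ltac inia := intros; nia.

(** * Loop inequality and four-point condition in discrete metrics *)

Section DiscreteLoops.
Variables (V : eqType) (d : V -> V -> nat).

Definition lip1 (f : V -> nat) : Prop := forall x y, f x <= f y + d x y.

Definition unit_step : rel V := fun x y => d x y <= 1.

(** A left Riemann-Stieltjes sum for the integral of [psi] against [df] along a path. *)
Fixpoint integral (psi f : V -> nat) (x : V) (p : seq V) : int :=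
  if p is y :: q then ((psi x)%:Z * ((f y)%:Z - (f x)%:Z) + integral psi f y q)%R
  else 0%R.

Definition loop_inequality (C : nat) : Prop :=
  forall psi f, lip1 psi -> lip1 f -> forall x p,
    path unit_step x p -> last x p = x ->
    (integral psi f x p <= (C * size p)%:Z)%R.

Definition discrete_geodesic (a : nat -> V) (n : nat) : Prop :=
  forall i j, i <= j -> j <= n -> d (a i) (a j) = j - i.

Lemma integral_cat psi f x p q :
  integral psi f x (p ++ q) =
  (integral psi f x p + integral psi f (last x p) q)%R.
Proof. by elim: p x => [|y p IHp] x /=; rewrite ?add0r // IHp addrA. Qed.

Lemma integral_eq0 psi f x p :
  {in x :: p, forall y, psi y = 0} -> integral psi f x p = 0%R.
Proof.
elim: p x => [//|y p IHp] x psi0 /=.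
rewrite psi0 ?mem_head // mul0r add0r IHp // => z zp.
by apply: psi0; rewrite in_cons zp orbT.
Qed.

Definition segment (a : nat -> V) i n := [seq a k | k <- iota i.+1 n].

Lemma last_segment a i n : last (a i) (segment a i n) = a (i + n).
Proof.
rewrite /segment; elim: n i => [|n IHn] i /=; first by rewrite addn0.
by rewrite IHn addSnnS.
Qed.

Lemma mem_segment a i n x : x \in a i :: segment a i n ->
  exists2 k, i <= k <= i + n & x = a k.
Proof.
rewrite -[_ :: _]/(map a (iota i n.+1)) => /mapP[k]; rewrite mem_iota => ik ->.
by exists k => //; ilia.
Qed.

Lemma path_segment a i n :
  (forall k, i <= k < i + n -> unit_step (a k) (a k.+1)) ->
  path unit_step (a i) (segment a i n).
Proof.
rewrite /segment; elim: n i => [//|n IHn] i step_a /=.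
rewrite step_a ?IHn //; last ilia.
by move=> k ik; apply: step_a; ilia.
Qed.

Lemma integral_segment psi f a i n :
  (forall k, i <= k < i + n -> f (a k.+1) = (f (a k)).+1) ->
  integral psi f (a i) (segment a i n) = Posz (\sum_(i <= k < i + n) psi (a k)).
Proof.
rewrite /segment; elim: n i => [|n IHn] i fS /=.
  by rewrite addn0 big_geq.
rewrite IHn => [|k ik]; last by apply: fS; ilia.
rewrite fS; last ilia.
rewrite -addSnnS [in RHS]big_ltn; last ilia.
by rewrite PoszD intS [(1 + _)%R]addrC addrAC subrr add0r mulr1.
Qed.

(** The last clause makes [d] the path metric of a connected graph, whose edges are the pairs at
    distance 1; it is the source of geodesics. *)
Definition discrete_metric : Prop :=
  [/\ forall x y, d x y = 0 <-> x = y, forall x y, d x y = d y x,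
      forall x y z, d x z <= d x y + d y z &
      forall x y n, d x y = n.+1 -> exists2 z, d x z = 1 & d z y = n].

Hypothesis d_metric : discrete_metric.

Lemma dmet0 x : d x x = 0. Proof. by have [/(_ x x)[_ ->]] := d_metric. Qed.
Lemma dmet_eq0 x y : d x y = 0 -> x = y.
Proof. by have [/(_ x y)[]] := d_metric. Qed.
Lemma dmetC x y : d x y = d y x. Proof. by have [_ ->] := d_metric. Qed.
Lemma dmet_tri y x z : d x z <= d x y + d y z.
Proof. by have [_ _ ->] := d_metric. Qed.

Lemma geodesic_exists x y :
  exists a, [/\ a 0 = x, a (d x y) = y & discrete_geodesic a (d x y)].
Proof.
move: {2}(d x y) (erefl (d x y)) => n; elim: n x => [|n IHn] x dxy.
  exists (fun=> x); rewrite dxy; split=> // [|i j _]; first exact: dmet_eq0.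
  by rewrite leqn0 => /eqP->; rewrite dmet0.
have [_ _ _ /(_ _ _ _ dxy)[z dxz dzy]] := d_metric.
have [a [a0 an geo_a]] := IHn _ dzy; rewrite dzy in an geo_a.
exists (fun i => if i is j.+1 then a j else x); rewrite dxy; split=> //.
case=> [|i] [|j] //= ij jn; rewrite ?dmet0 ?geo_a //.
have := geo_a 0 j isT jn; have := geo_a j n jn (leqnn n); rewrite a0 an.
by have := dmet_tri z x (a j); have := dmet_tri (a j) x y; ilia.
Qed.

Definition joined (P : V -> Prop) x y n : Prop := exists p,
  [/\ path unit_step x p, last x p = y, size p <= n &
      {in x :: p, forall z, P z}].

Lemma joined_sym P x y n : joined P x y n -> joined P y x n.
Proof.
move=> [p [xp py sz_p Pp]]; exists (rev (belast x p)); split.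
- rewrite -py rev_path; apply: sub_path xp => u v.
  by rewrite /unit_step /= dmetC.
- by case: p py {xp sz_p Pp} => //= z p _; rewrite rev_cons last_rcons.
- by rewrite size_rev size_belast.
- move=> z; rewrite -py in_cons mem_rev => z_in.
  by apply: Pp; rewrite lastI mem_rcons in_cons.
Qed.

Lemma joined_trans P y x z m n :
  joined P x y m -> joined P y z n -> joined P x z (m + n).
Proof.
move=> [p [xp py sz_p Pp]] [q [yq qz sz_q Pq]]; exists (p ++ q); split.
- by rewrite cat_path xp py.
- by rewrite last_cat py.
- by rewrite size_cat leq_add.
- move=> u; rewrite -cat_cons mem_cat => /orP[/Pp //|uq].
  by apply: Pq; rewrite in_cons uq orbT.
Qed.

Lemma joined_segment (P : V -> Prop) a i j :
  i <= j -> (forall k, i <= k < j -> unit_step (a k) (a k.+1)) ->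
  (forall k, i <= k <= j -> P (a k)) -> joined P (a i) (a j) (j - i).
Proof.
move=> ij step_a Pa; exists (segment a i (j - i)); split.
- by apply: path_segment => k ik; apply: step_a; ilia.
- by rewrite last_segment subnKC.
- by rewrite size_map size_iota.
- by move=> z /mem_segment[k ik ->]; apply: Pa; ilia.
Qed.

Lemma geodesic_step a n k :
  discrete_geodesic a n -> k < n -> unit_step (a k) (a k.+1).
Proof. by move=> geo_a kn; rewrite /unit_step geo_a; ilia. Qed.

Lemma joined_geodesic (P : V -> Prop) x y :
  (forall z, d x z <= d x y -> P z) -> joined P x y (d x y).
Proof.
move=> Pxy; have [a [a0 an geo_a]] := geodesic_exists x y.
rewrite -{1}a0 -{1}an -{2}[d x y]subn0; apply: joined_segment => // k ik.
  by apply: geodesic_step geo_a _; ilia.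
by apply: Pxy; rewrite -{1}a0 geo_a; ilia.
Qed.

(** The right half of the tent alone contributes D + (D - 1) + ... + 1, which is at least D^2 / 2.
    With truncated subtraction, [k - t + (t - k)] is an absolute value. *)
Lemma sum_tent D i j t : i <= t -> t + D <= j ->
  D * D <= 2 * \sum_(i <= k < j) (D - (k - t + (t - k))).
Proof.
move=> it tj.
have tent n : n <= D ->
    2 * D * n <= 2 * \sum_(t <= k < t + n) (D - (k - t + (t - k))) + n * n.
  elim: n => [|n IHn] nD; first by rewrite muln0.
  by rewrite addnS big_nat_recr /=; [have := IHn (ltnW nD); inia | ilia].
rewrite [in leqRHS](@big_cat_nat _ _ _ t) //=; last ilia.
rewrite [X in _ + X](@big_cat_nat _ _ _ (t + D)) //=; last ilia.
by have := tent D (leqnn D); ilia.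
Qed.

(** * The Morse lemma from the loop inequality *)

Section Morse.
Variables (C : nat) (loop_C : loop_inequality C).
Variables (a g : nat -> V) (T N : nat).
Hypotheses (geo_a : discrete_geodesic a T) (ga0 : g 0 = a 0) (gaT : g N = a T).
Hypothesis step_g : forall k, k < N -> unit_step (g k) (g k.+1).
Hypothesis quasi_g :
  forall i j, i <= j -> j <= N -> j - i <= 3 * d (g i) (g j).

(** A maximum of minima over finite index ranges: [D] is the largest distance from a point of [a] to
    [g], attained at [a t]. *)
Lemma farthest_point : exists t D, [/\ t <= T,
  forall i, i <= N -> D <= d (a t) (g i) &
  forall s, s <= T -> exists2 i, i <= N & d (a s) (g i) <= D].
Proof.
pose m t := [arg min_(i < (ord0 : 'I_N.+1)) d (a t) (g i)].
have mP t i : i <= N -> d (a t) (g (m t)) <= d (a t) (g i).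
  move=> iN; rewrite /m; case: arg_minnP => // k _ /(_ (Ordinal (iN : i < N.+1))).
  exact.
pose t := [arg max_(t > (ord0 : 'I_T.+1)) d (a t) (g (m t))].
exists t, (d (a t) (g (m t))); split=> [|i|s sT]; first exact: leq_ord.
  exact: mP.
exists (m s); first exact: leq_ord.
rewrite /t; case: arg_maxnP => // k _ /(_ (Ordinal (sT : s < T.+1))).
exact.
Qed.

(* At the point of [a] farthest from [g], at distance D, the loop made of the
   4D-neighbourhood of that point in [a] and of a detour along [g] has length
   O(D), while the integral of the tent function of radius D against the
   arclength of [a] only sees [a] and is at least D^2 / 2. *)
Lemma geodesic_near_quasigeodesic t : t <= T ->
  exists2 i, i <= N & d (a t) (g i) <= 48 * C.
Proof.
move=> tT; have [t0 [D [t0T far near]]] := farthest_point.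
have [i iN dti] := near t tT; exists i => //; apply: leq_trans dti _.
pose away z := D <= d (a t0) z.
have d_t0 k : k <= T -> d (a t0) (a k) = (k - t0) + (t0 - k).
  move=> kT; have [ge|le] := leqP t0 k; first by rewrite geo_a //; ilia.
  by rewrite dmetC geo_a //; ilia.
have join_g k l : k <= N -> l <= N ->
    joined away (g k) (g l) (3 * d (g k) (g l)).
  wlog kl : k l / k <= l => [th|] kN lN.
    have [kl|lk] := leqP k l; first exact: th.
    by rewrite dmetC; apply/joined_sym/th => //; exact: ltnW.
  have [p [gp pl sz_p Pp]] : joined away (g k) (g l) (l - k).
    apply: joined_segment => // j jk; first by apply: step_g; ilia.
    by apply: far; ilia.
  by exists p; split=> //; apply: leq_trans sz_p _; apply: quasi_g.
(* A shortest path from [a s] to [g] has length at most D and starts at distance at least 2D from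
   [a t0], so it never comes closer to [a t0] than D. *)
have join_ag s : s <= T -> 2 * D <= d (a t0) (a s) ->
    exists2 j, j <= N & d (a s) (g j) <= D /\ joined away (a s) (g j) D.
  move=> sT t0s; have [j jN dj] := near s sT; exists j => //; split=> //.
  have [z|p [ap pj sz_p Pp]] := @joined_geodesic away (a s) (g j).
    by rewrite /away; have := dmet_tri z (a t0) (a s); rewrite (dmetC z); ilia.
  by exists p; split=> //; apply: leq_trans sz_p _.
have joinxx k : k <= N -> joined away (g k) (g k) D.
  by move=> kN; exists [::]; split=> // z; rewrite inE => /eqP ->; exact: far.
(* If [t0] is within 2D of the start of [a], the common endpoint [a 0 = g 0] serves, with a trivial
   path; lying on [g], it is at distance at least D from [a t0]. *)
have [s [s_t0 t0_s [j jN [dsj sj]]]] : exists s, [/\ s + D <= t0,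
    t0 <= s + 2 * D &
    exists2 j, j <= N & d (a s) (g j) <= D /\ joined away (a s) (g j) D].
  have [le|lt] := leqP t0 (2 * D).
    exists 0; split=> //.
      by have := far 0 isT; rewrite ga0 d_t0 //; ilia.
    by exists 0 => //; rewrite -ga0 dmet0; split; last exact: joinxx.
  exists (t0 - 2 * D); split; [ilia | ilia | apply: join_ag; first ilia].
  by rewrite d_t0; ilia.
have [u [u_t0 t0_u uT [l lN [dul ul]]]] : exists u, [/\ t0 + D <= u,
    u <= t0 + 2 * D, u <= T &
    exists2 j, j <= N & d (a u) (g j) <= D /\ joined away (a u) (g j) D].
  have [le|lt] := leqP T (t0 + 2 * D).
    exists T; split=> //.
      by have := far N (leqnn N); rewrite gaT d_t0 //; ilia.
    by exists N => //; rewrite -gaT dmet0; split; last exact: joinxx.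
  exists (t0 + 2 * D); split; [ilia | ilia | ilia | apply: join_ag; first ilia].
  by rewrite d_t0; ilia.
have [q [uq qs sz_q away_q]] :=
  joined_trans (joined_trans ul (join_g l j lN jN)) (joined_sym sj).
have dlj : d (g l) (g j) <= 6 * D.
  have := dmet_tri (a u) (g l) (g j); have := dmet_tri (a s) (a u) (g j).
  by rewrite (dmetC (g l) (a u)) (dmetC (a u) (a s)) geo_a; ilia.
pose psi z := D - d (a t0) z; pose f z := d (a 0) z.
have lip_psi : lip1 psi.
  by move=> x y; rewrite /psi; have := dmet_tri x (a t0) y; ilia.
have lip_f : lip1 f.
  by move=> x y; rewrite /f (dmetC x); exact: dmet_tri.
have := loop_C lip_psi lip_f (x := a s) (p := segment a s (u - s) ++ q).
have su : s + (u - s) = u by ilia.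
rewrite cat_path last_cat integral_cat last_segment su uq qs andbT.
rewrite path_segment; last by move=> k ik; apply: geodesic_step geo_a _; ilia.
move=> /(_ isT erefl); rewrite integral_segment => [|k ik]; last first.
  by rewrite /f !geo_a //; ilia.
rewrite integral_eq0 => [|z /away_q]; last by rewrite /away /psi; ilia.
rewrite size_cat size_map size_iota addr0 lez_nat su.
have -> : \sum_(s <= k < u) psi (a k) =
    \sum_(s <= k < u) (D - (k - t0 + (t0 - k))).
  by apply: eq_big_nat => k ik; rewrite /psi d_t0 //; ilia.
(* The loop has at most 4D + D + 18D + D = 24D steps, so D^2 <= 2 * C * 24D; hence the constant 48
   C. *)
have := @sum_tent D s u t0; inia.
Qed.

End Morse.

(** * The four-point condition from nearest-point projections *)

Section FourPoints.
Variables (C : nat) (loop_C : loop_inequality C).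

(* A geodesic followed by a shortest path to a point c, starting from a point
   of the geodesic nearest to c, is a (3,0)-quasi-geodesic. *)
Lemma nearest_point_detour b n c :
  discrete_geodesic b n -> (forall i, i <= n -> d (b n) c <= d (b i) c) ->
  n + d (b n) c <= d (b 0) c + (288 * C + 4).
Proof.
move=> geo_b near_b; have [e [e0 ec geo_e]] := geodesic_exists (b n) c.
set m := d (b n) c in near_b ec geo_e *.
have [a [a0 ac geo_a]] := geodesic_exists (b 0) c.
set T := d (b 0) c in ac geo_a *.
have d_ec j : j <= m -> d (e j) c = m - j.
  by move=> jm; rewrite -ec geo_e.
(* The point [c] is at distance at least m from [b i] and exactly m - j from [e j]. *)
have dbe i j : i <= n -> j <= m -> j <= d (b i) (e j).
  move=> le_in jm; have := dmet_tri (e j) (b i) c; have := near_b i le_in.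
  by have := d_ec j jm; ilia.
pose g k := if k <= n then b k else e (k - n).
have gb k : k <= n -> g k = b k by rewrite /g => ->.
have ge k : n <= k -> g k = e (k - n).
  rewrite /g leq_eqVlt => /orP[/eqP <-|]; first by rewrite leqnn subnn e0.
  by rewrite ltnNge => /negbTE ->.
have step_g k : k < n + m -> unit_step (g k) (g k.+1).
  move=> km; have [kn|nk] := ltnP k n.
    by rewrite !gb ?(ltnW kn) //; apply: geodesic_step geo_b _.
  rewrite !ge ?(leqW nk) // subSn //; apply: geodesic_step geo_e _; ilia.
(* Across the corner, with [e k] the second point, n - i <= d (b i) (e k) + k and k <= d (b i) (e k)
   by [dbe]; thus (n - i) + k is at most three times the distance. *)
have quasi_g i j : i <= j -> j <= n + m -> j - i <= 3 * d (g i) (g j).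
  move=> ij jnm; have [jn|nj] := leqP j n.
    by rewrite !gb //; [rewrite geo_b //; ilia | ilia].
  have [ni|le_in] := leqP n i.
    by rewrite !ge ?geo_e; ilia.
  have := dbe i (j - n); rewrite (gb i) ?(ge j) ?(ltnW le_in) ?(ltnW nj) //.
  have := dmet_tri (e (j - n)) (b i) (b n); rewrite geo_b ?(ltnW le_in) //.
  rewrite (dmetC _ (b n)) -{1}e0 geo_e //; last ilia.
  by move=> h /(_ isT); ilia.
have g0 : g 0 = a 0 by rewrite gb.
have gT : g (n + m) = a T by rewrite ge ?leq_addr // addKn ec ac.
have near := geodesic_near_quasigeodesic loop_C geo_a g0 gT step_g quasi_g.
have {}near t : t <= T -> (exists2 i, i <= n & d (a t) (b i) <= 48 * C) \/
    (exists2 j, j <= m & d (a t) (e j) <= 48 * C).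
  move=> tT; have [k km dk] := near t tT.
  have [kn|nk] := leqP k n.
    by left; exists k => //; rewrite -gb.
  by right; exists (k - n); [ilia | rewrite -ge // ltnW].
(* [P] holds at 0 because [a 0 = b 0]. If it also holds at T, then [c = a T] is near [b], so m <= 48
   C and the triangle inequality concludes. *)
pose P t := `[< exists2 i, i <= n & d (a t) (b i) <= 48 * C >].
have [[i le_in di]|notP] := pselect (exists2 i, i <= n & d (a T) (b i) <= 48 * C).
  have := near_b i le_in; rewrite dmetC ac in di => mi.
  have := dmet_tri c (b 0) (b n); rewrite geo_b // (dmetC c) -/T -/m; ilia.
(* Where [a] leaves the neighbourhood of [b] it enters that of [e]. There [dbe] gives j <= 96 C + 1,
   so [a t.+1] is within 144 C + 1 of [b n]; splitting [a] at this place yields n + m <= T + 288 C +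
   2. *)
have [t [tT Pt NPt]] : exists t, [/\ t < T, P t & ~ P t.+1].
  apply: contrapT => noT.
  have allP s : s <= T -> P s.
    elim: s => [|s IHs] sT.
      by apply/asboolP; exists 0; rewrite // a0 dmet0.
    by apply: contrapT => NPs; apply: noT; exists s; split=> //; apply/IHs/ltnW.
  exact/notP/asboolP/allP.
have /asboolP[i le_in di] := Pt.
have [/asboolP //|[j jm dj]] := near t.+1 tT.
have at_aSt : d (a t) (a t.+1) = 1 by rewrite geo_a; ilia.
have := dmet_tri (a t) (b i) (e j); have := dmet_tri (a t.+1) (a t) (e j).
have := dbe i j le_in jm; rewrite (dmetC (b i) (a t)) => h1 h2 h3.
have enj : d (e j) (b n) = j by rewrite dmetC -e0 geo_e ?subn0.
have h4 := dmet_tri (e j) (a t.+1) (b n).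
have h5 := dmet_tri (a t) (b 0) (b n); have h6 := dmet_tri (a t.+1) (b n) c.
have h7 := dmet_tri (a t.+1) (a t) (b n).
have d_at1c : d (a t.+1) c = T - t.+1 by rewrite -ac geo_a.
rewrite (dmetC (b n) (a t.+1)) d_at1c -/m in h6.
rewrite geo_b // -a0 geo_a ?(ltnW tT) // in h5.
by ilia.
Qed.

(** Project [x] and [z] to points [a i] and [a j] of a geodesic from [w] to [y], and bound the
    distance from [x] to [z] by the path through both projections. The order of i and j decides
    which alternative holds; each projection costs one error [288 * C + 4]. *)
Lemma four_points : exists E, forall w x y z,
  d w y + d x z <= d w z + d x y + E \/ d w y + d x z <= d w x + d y z + E.
Proof.
pose E := 288 * C + 4; exists (2 * E) => w x y z.
have [a [aw ay geo_a]] := geodesic_exists w y; set T := d w y in ay geo_a *.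
have proj c : exists2 i, i <= T &
    i + d (a i) c <= d w c + E /\ T - i + d (a i) c <= d y c + E.
  pose i : 'I_T.+1 := [arg min_(i < (ord0 : 'I_T.+1)) d (a i) c].
  have near_i j : j <= T -> d (a i) c <= d (a j) c.
    move=> jT; rewrite /i; case: arg_minnP => // k _.
    by move=> /(_ (Ordinal (jT : j < T.+1))); apply.
  have iT : i <= T by exact: leq_ord.
  exists i => //; split.
    rewrite -aw; apply: nearest_point_detour => [j k jk ki|j ji].
      by apply: geo_a; ilia.
    by apply: near_i; ilia.
  (* The other half of the geodesic is traversed backwards, from [y] to the projection. *)
  have := @nearest_point_detour (fun k => a (T - k)) (T - i) c.
  rewrite subKn // subn0 ay; apply=> [j k jk ki|j ji].
    by rewrite dmetC geo_a; ilia.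
  by apply: near_i; ilia.
have [i iT [wi yi]] := proj x; have [j jT [wj yj]] := proj z.
have dij : d (a i) (a j) = (j - i) + (i - j).
  by have [ge|le] := leqP i j; [rewrite geo_a | rewrite dmetC geo_a]; ilia.
have := dmet_tri (a i) x z; have := dmet_tri (a j) (a i) z.
by rewrite (dmetC x (a i)) (dmetC x y); ilia.
Qed.

End FourPoints.

End DiscreteLoops.

(** * Word metrics and Cayley graphs *)

Local Open Scope classical_set_scope.
Local Open Scope group_scope.

Section WordMetricTheory.
Variables (G : groupType) (S : set G).
Implicit Types (x y g : G) (w : seq G).

Lemma sym_setV g : sym_set S g -> sym_set S g^-1.
Proof.
by case=> [Sg|[h Sh <-]]; [right; exists g | left; rewrite invgK].
Qed.

Lemma spells_cat v w g h :
  spells S v g -> spells S w h -> spells S (v ++ w) (g * h).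
Proof.
move=> [Sv <-] [Sw <-]; split; last by rewrite big_cat.
by move=> s; rewrite mem_cat => /orP[/Sv|/Sw].
Qed.

Lemma spells_nil : spells S [::] 1.
Proof. by split; rewrite ?big_nil. Qed.

Lemma spells1 g : sym_set S g -> spells S [:: g] g.
Proof. by move=> Sg; split=> [s|]; rewrite ?big_seq1 // inE => /eqP ->. Qed.

Lemma spellsV w g : spells S w g -> spells S (rev (map (fun s => s^-1) w)) g^-1.
Proof.
move=> [Sw <-]; elim: w Sw => [|s w IHw] Sw.
  by rewrite big_nil invg1; exact: spells_nil.
rewrite big_cons invgM /= rev_cons -cats1; apply: spells_cat.
  by apply: IHw => t tw; apply: Sw; rewrite inE tw orbT.
by apply/spells1/sym_setV/Sw; rewrite mem_head.
Qed.

Hypothesis genS : generates S.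

Lemma word_length_le w g : spells S w g -> (word_length S g <= size w)%N.
Proof. by have [_ le_w] := word_lengthP g genS => /le_w. Qed.

Lemma word_length_spells g : exists2 w, spells S w g & size w = word_length S g.
Proof. by have [] := word_lengthP g genS. Qed.

Lemma word_dist_le1 x y :
  (word_dist S x y <= 1)%N -> x = y \/ sym_set S (x^-1 * y).
Proof.
rewrite /word_dist; have [w [Sw wg] <-] := word_length_spells (x^-1 * y).
case: w Sw wg => [|s [|]] //= Sw; rewrite ?big_nil ?big_seq1 => wg _.
  by left; rewrite -[y](mulVKg x) -wg mulg1.
by right; rewrite -wg; apply: Sw; rewrite mem_head.
Qed.

Lemma word_dist_sym_set x y : sym_set S (x^-1 * y) -> (word_dist S x y <= 1)%N.
Proof. by move=> /spells1 /word_length_le. Qed.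

Lemma discrete_metric_word_dist : discrete_metric (word_dist S).
Proof.
have sym x y : (word_dist S x y <= word_dist S y x)%N.
  rewrite /word_dist; have [w Sw <-] := word_length_spells (y^-1 * x).
  rewrite -[in leqRHS](size_map (fun s => s^-1)) -size_rev; apply: word_length_le.
  by rewrite -[x^-1 * y]invgK invgM invgK; exact: spellsV.
have tri x y z : (word_dist S x z <= word_dist S x y + word_dist S y z)%N.
  rewrite /word_dist; have [v Sv <-] := word_length_spells (x^-1 * y).
  have [w Sw <-] := word_length_spells (y^-1 * z).
  rewrite -size_cat; apply: word_length_le.
  by have := spells_cat Sv Sw; rewrite -mulgA mulVKg.
split=> [x y|x y|//|x y n].
- split=> [|->]; last first.
    apply/eqP; rewrite /word_dist mulVg -leqn0; exact: word_length_le spells_nil.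
  rewrite /word_dist; have [w [_ wg] <-] := word_length_spells (x^-1 * y).
  case: w wg => //; rewrite big_nil => wg _.
  by rewrite -[y](mulVKg x) -wg mulg1.
- by apply/eqP; rewrite eqn_leq !sym.
- move=> dxy; have [w [Sw wg] sz_w] := word_length_spells (x^-1 * y).
  rewrite -/(word_dist S x y) dxy in sz_w; case: w Sw wg sz_w => //= s w Sw.
  rewrite big_cons => wg [sz_w].
  have Ss : sym_set S s by apply: Sw; rewrite mem_head.
  have dxs : (word_dist S x (x * s) <= 1)%N.
    by apply: word_dist_sym_set; rewrite mulKg.
  have dsy : (word_dist S (x * s) y <= n)%N.
    rewrite -sz_w; apply: word_length_le; split=> [t tw|].
      by apply: Sw; rewrite inE tw orbT.
    by rewrite invgM -mulgA -wg mulKg.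
  by exists (x * s); have := tri x (x * s) y; ilia.
Qed.

End WordMetricTheory.

(** * From vertices to all points of the Cayley graph *)

Section CayleySpaceTheory.
Variables (K : realType) (G : groupType) (S : set G) (genS : generates S).
Implicit Types (p q : cayley_point K S).
Local Open Scope ring_scope.

Definition near_vertex p : G :=
  match p with CVertex x => x | CEdge x _ _ _ _ => x end.

Let edge_dist (x y s : G) : S s ->
  (word_dist S x (y * s)%g <= word_dist S x y + 1)%N /\
  (word_dist S x y <= word_dist S x (y * s)%g + 1)%N.
Proof.
move=> Ss; have dm := discrete_metric_word_dist genS.
have ys : (word_dist S y (y * s)%g <= 1)%N.
  by apply: word_dist_sym_set => //; rewrite mulKg; left.
have := dmet_tri dm y x (y * s)%g; have := dmet_tri dm (y * s)%g x y.
by rewrite (dmetC dm (y * s)%g y); ilia.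
Qed.

Lemma vertex_dist_near x p :
  `|vertex_dist x p - (word_dist S x (near_vertex p))%:R| <= 1.
Proof.
case: p => [y|y s t Ss t01] /=; first by rewrite subrr normr0.
have [] := edge_dist x y Ss; rewrite -!(ler_nat K) !natrD => h1 h2.
by rewrite ler_norml /Num.min; case: ifP; lra.
Qed.

(** One unit of error is for the position of [p] on its edge, one for passing to the other end of
    that edge, and one for the position of [q]. *)
Lemma cayley_dist_near p q :
  `|cayley_dist p q - (word_dist S (near_vertex p) (near_vertex q))%:R| <= 3.
Proof.
have dm := discrete_metric_word_dist genS.
case: p => [x|x s t Ss t01] /=.
  by have := vertex_dist_near x q; rewrite !ler_norml; lra.
have near_d : `|Num.min (t + vertex_dist x q) (1 - t + vertex_dist (x * s)%g q)
    - (word_dist S x (near_vertex q))%:R| <= 3.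
  have := vertex_dist_near x q; have := vertex_dist_near (x * s)%g q.
  have [] := edge_dist (near_vertex q) x Ss; rewrite !(dmetC dm (near_vertex q)).
  rewrite -!(ler_nat K) !natrD => h1 h2; rewrite !ler_norml => h3 h4.
  by rewrite /Num.min; case: ifP; lra.
case: q near_d => [//|y r u Sr u01] /= near_d.
case: ifP => // /andP[/eqP xy _]; move: near_d; rewrite -xy (dmet0 dm) !subr0.
have : `|t - u| <= 1 by rewrite ler_norml; lra.
have := normr_ge0 (t - u); move: (`|t - u|) (Num.min (t + _) _) => e m.
by rewrite !ler_norml /Num.min; case: ifP; lra.
Qed.

Lemma four_points_hyperbolic (E : nat) :
  (forall w x y z, (word_dist S w y + word_dist S x z <=
      word_dist S w z + word_dist S x y + E)%N \/
    (word_dist S w y + word_dist S x z <=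
      word_dist S w x + word_dist S y z + E)%N) ->
  gromov_hyperbolic (@cayley_dist K G S).
Proof.
(* Each alternative compares four distances, each within 3 of a word distance: a total error of 12,
   before the halving in the Gromov product. *)
move=> four; exists (E%:R + 12) => w x y z.
rewrite /gromov_product lerBlDr ge_min; apply/orP.
have dm := discrete_metric_word_dist genS.
have := cayley_dist_near x w; have := cayley_dist_near y w.
have := cayley_dist_near x y; have := cayley_dist_near y z.
have := cayley_dist_near x z; have := cayley_dist_near z w.
rewrite !ler_norml => h1 h2 h3 h4 h5 h6.
have E0 : 0 <= E%:R :> K by exact: ler0n.
have := four (near_vertex w) (near_vertex x) (near_vertex y) (near_vertex z).
rewrite !(dmetC dm (near_vertex w)) -!(ler_nat K) !natrD.
by case=> h; [left | right]; lra.
Qed.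

End CayleySpaceTheory.

Lemma finite_uniform_bound (T : choiceType) (A : set T) (P : T -> nat -> Prop) :
  finite_set A -> (forall x m n, (m <= n)%N -> P x m -> P x n) ->
  (forall x, A x -> exists n, P x n) -> exists N, forall x, A x -> P x N.
Proof.
move=> /finite_seqP[s ->] monoP; elim: s => [|x s IHs] exP; first by exists 0%N.
have [|N PN] := IHs; first by move=> y ys; apply: exP; rewrite /= inE ys orbT.
have [|n Pn] := exP x; first by rewrite /= mem_head.
exists (N + n)%N => y; rewrite /= inE => /orP[/eqP ->|/PN].
  by apply: monoP Pn; rewrite leq_addl.
by apply: monoP; rewrite leq_addr.
Qed.

Lemma finite_sym_set (G : groupType) (S : set G) :
  finite_set S -> finite_set (sym_set S).
Proof. by move=> finS; rewrite finite_setU; split=> //; apply: finite_image. Qed.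

(** * Integrals along words in the free product *)

Section LetterIntegrals.
Variables (G : groupType) (X : set G) (m : nat) (H : 'I_m -> groupClosed G).
Implicit Types (g : G) (a : letter X H) (u v w : seq (letter X H)).

(** The choice depends on the coset [g H_i] only as a set, so all its elements share one
    representative. The default 1 never occurs, since [g] lies in its coset. *)
Definition coset_rep (i : 'I_m) g : G := xget 1 [set u | g^-1 * u \in H i].

Lemma coset_rep_in i g : g^-1 * coset_rep i g \in H i.
Proof.
by rewrite /coset_rep; case: xgetP => [x _ //|/(_ g)]; rewrite /= mulVg gpred1.
Qed.

Lemma coset_repM i g h : h \in H i -> coset_rep i (g * h) = coset_rep i g.
Proof.
move=> Hh; rewrite /coset_rep; congr xget; apply/funext => u /=.
by rewrite invgM -mulgA gpredMl // gpredV.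
Qed.

(** N-Lipschitz on the coned-off Cayley graph; since letters are closed under inversion, one
    inequality yields both. *)
Definition letter_lip (N : nat) (phi : G -> nat) : Prop :=
  forall g a, (phi (g * letter_val a)%g <= phi g + N)%N.

Lemma letter_val_inv a : letter_val (letter_inv a) = (letter_val a)^-1.
Proof. by case: a => [[x []]|[i h]] //=; rewrite invgK. Qed.

Lemma letter_lipV N phi g a :
  letter_lip N phi -> (phi g <= phi (g * letter_val a)%g + N)%N.
Proof.
by move=> /(_ (g * letter_val a) (letter_inv a)); rewrite letter_val_inv mulgK.
Qed.

Section Integral.
Variables (psi f : G -> nat).
Local Open Scope ring_scope.

(* A letter of H_i is an edge path through a cone vertex attached to the coset
   g H_i, at which psi takes the value [psi (coset_rep i g)]; thus the integral
   only depends on the element of the free product. *)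
Definition edge_weight g a : nat :=
  match a with
  | inl (x, e) => if e then psi (g * (\val x)^-1)%g else psi g
  | inr (existT i _) => psi (coset_rep i g)
  end.

Fixpoint word_integral g w : int :=
  if w is a :: v then
    (edge_weight g a)%:Z * ((f (g * letter_val a)%g)%:Z - (f g)%:Z)
      + word_integral (g * letter_val a)%g v
  else 0.

Lemma word_integral_cat g u v :
  word_integral g (u ++ v) =
  word_integral g u + word_integral (g * word_val u)%g v.
Proof.
elim: u g => [|a u IHu] g /=; first by rewrite add0r /word_val big_nil mulg1.
by rewrite IHu addrA /word_val big_cons mulgA.
Qed.

(** An edge labelled x or x^-1 is weighted at the start of its x-orientation, so going forth and
    back cancels. Inside one coset of H_i the weight is constant, so the increments of [f]
    telescope. *)
Lemma word_integral_free_eq u v :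
  free_eq u v -> word_integral^~ u =1 word_integral^~ v.
Proof.
elim=> {u v} //.
- by move=> u v _ IH g; rewrite IH.
- by move=> u v w _ IHuv _ IHvw g; rewrite IHuv.
- move=> u u' v v' eq_u IHu _ IHv g.
  by rewrite !word_integral_cat IHu IHv (free_eq_val eq_u).
- move=> x [] g /=; rewrite addr0 ?mulgK ?mulgVK.
    by rewrite -mulrDr addrC subrKA subrr mulr0.
  by rewrite -mulrDr addrC subrKA subrr mulr0.
- by move=> i g /=; rewrite mulg1 subrr mulr0 addr0.
- move=> i h k g /=; rewrite !addr0 coset_repM ?(valP h) // mulgA -mulrDr.
  by rewrite addrC subrKA.
Qed.

Definition free_integral g (x : free_product X H) : int :=
  word_integral g (free_repr x).

Lemma free_integralE g w : free_integral g (free_class w) = word_integral g w.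
Proof. exact: word_integral_free_eq (free_class_repr w) g. Qed.

Lemma free_integral1 g : free_integral g 1%g = 0.
Proof. exact: (free_integralE g [::]). Qed.

Lemma free_integralM g x y :
  free_integral g (x * y)%g =
  free_integral g x + free_integral (g * free_to_group x)%g y.
Proof. by rewrite [LHS]free_integralE word_integral_cat. Qed.

(** As [r] is a loop, the path [x] is run back from where [x^-1] ended, and the two contributions
    cancel. *)
Lemma free_integral_conj g x r : free_to_group r = 1%g ->
  free_integral g (x^-1 * r * x)%g = free_integral (g / free_to_group x)%g r.
Proof.
have [to1 toM] := @free_to_group_morphism _ X _ H.
have toV : free_to_group x^-1%g = (free_to_group x)^-1%g.
  by apply/esym/mulg1_eq; rewrite -toM mulgV to1.
move=> r1; rewrite !free_integralM toM r1 mulg1 addrAC.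
by rewrite -free_integralM mulVg free_integral1 add0r toV.
Qed.

(** Each conjugate contributes the integral of an element of [A] at another base point, which is why
    the bound [B] is uniform in [g]. *)
Lemma free_integral_conjugate_product (A : set (free_product X H)) (B k : nat) :
  (forall r, A r -> free_to_group r = 1%g) ->
  (forall r g, A r -> `|free_integral g r| <= B%:Z) ->
  forall g x, is_conjugate_product A k x -> `|free_integral g x| <= (k * B)%:Z.
Proof.
move=> A1 leB g x [c [r [Ar ->]]] {x}.
elim: k g c r Ar => [|k IHk] g c r Ar.
  by rewrite big_ord0 free_integral1 normr0.
rewrite big_ord_recl free_integralM free_integral_conj; last exact: A1.
apply: le_trans (ler_normD _ _) _; rewrite mulSn PoszD lerD //.
  exact: leB.
exact: IHk.
Qed.

Variable N : nat.
Hypotheses (lip_psi : letter_lip N psi) (lip_f : letter_lip N f).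

Lemma coset_rep_lip i g : (psi (coset_rep i g) <= psi g + N)%N /\
  (psi g <= psi (coset_rep i g) + N)%N.
Proof.
pose a := H_letter X (exist (fun x => x \in H i) _ (coset_rep_in i g)).
have := lip_psi g a; have := letter_lipV g a lip_psi.
by rewrite /= mulVKg.
Qed.

Lemma edge_weight_lip g a : `|(edge_weight g a)%:Z - (psi g)%:Z| <= N%:Z.
Proof.
case: a => [[x []]|[i h]] /=.
- have := lip_psi g (X_letter H x true).
  have := letter_lipV g (X_letter H x true) lip_psi.
  by rewrite /=; ilia.
- by ilia.
- by have := coset_rep_lip i g; ilia.
Qed.

(** Along the word the weights drift from [c] by at most N per letter, plus N for [edge_weight].
    Leaving [c] free lets the induction move the base point; with [c = psi g] the bound depends only
    on N and the length of [w]. *)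
Lemma word_integral_bound (c : int) g w :
  `|word_integral g w - c * ((f (g * word_val w)%g)%:Z - (f g)%:Z)| <=
  ((size w * N)%:Z * (`|(psi g)%:Z - c| + ((size w).+1 * N)%:Z)).
Proof.
elim: w g => [|a w IHw] g /=.
  by rewrite /word_val big_nil mulg1 subrr mulr0 subrr normr0.
have := IHw (g * letter_val a)%g; rewrite -mulgA.
have -> : (letter_val a * word_val w)%g = word_val (a :: w).
  by rewrite /word_val big_cons.
set I := word_integral _ _; set f1 := f (g * letter_val a)%g; set f2 := f _.
set p1 := psi (g * _)%g => IH.
have he := edge_weight_lip g a; set e := edge_weight _ _ in he *.
have f1g : `|f1%:Z - (f g)%:Z| <= N%:Z.
  by have := lip_f g a; have := letter_lipV g a lip_f; rewrite -/f1; ilia.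
have p1g : `|p1%:Z - c| <= `|(psi g)%:Z - c| + N%:Z.
  by have := lip_psi g a; have := letter_lipV g a lip_psi; rewrite -/p1; ilia.
have ec : `|e%:Z - c| <= `|(psi g)%:Z - c| + N%:Z by ilia.
have -> : e%:Z * (f1%:Z - (f g)%:Z) + I - c * (f2%:Z - (f g)%:Z) =
    (I - c * (f2%:Z - f1%:Z)) + (e%:Z - c) * (f1%:Z - (f g)%:Z) by ring.
apply: le_trans (ler_normD _ _) _; rewrite normrM.
apply: le_trans (lerD IH (ler_pM _ _ ec f1g)) _ => //.
have h : (size w * N)%:Z * (`|p1%:Z - c| + ((size w).+1 * N)%:Z) <=
    (size w * N)%:Z * (`|(psi g)%:Z - c| + N%:Z + ((size w).+1 * N)%:Z).
  by apply: ler_wpM2l => //; rewrite lerD2r.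
apply: le_trans (lerD h (lexx _)) _; rewrite -subr_ge0.
set r := (X in 0 <= X); have -> : r = ((size w).+1 * N * N)%:Z; last by [].
by rewrite /r !PoszM !intS; ring.
Qed.

End Integral.

Lemma letter_word_exists g :
  generates (rel_generating_set H X) ->
  exists w : seq (letter X H), XH_word w /\ word_val w = g.
Proof.
move=> /(_ g)[s [+ <-]]; elim: s => [|x s IHs] Ss.
  by exists [::]; rewrite /word_val !big_nil.
rewrite big_cons; have [|w [XHw <-]] := IHs.
  by move=> y ys; apply: Ss; rewrite inE ys orbT.
suff [v [XHv <-]] : exists v : seq (letter X H), XH_word v /\ word_val v = x.
  by exists (v ++ w); rewrite /XH_word all_cat word_val_cat; split=> //;
    exact/andP.
have Xletter y e : X y -> exists v : seq (letter X H),
    XH_word v /\ word_val v = if e then y^-1 else y.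
  move=> Xy; exists [:: X_letter H (SigSub (mem_set Xy)) e].
  by rewrite /word_val big_seq1.
have Hletter i y : y \in H i -> exists v : seq (letter X H),
    XH_word v /\ word_val v = y.
  move=> Hy; pose h : subgroup_type (H i) := exist (fun x => x \in H i) y Hy.
  (* Words satisfying [XH_word] have no trivial letters, so 1 is spelled by the empty word. *)
  have [h1|h1] := eqVneq h 1.
    by exists [::]; rewrite /word_val big_nil -[y]/(val h) h1.
  by exists [:: H_letter X h]; rewrite /word_val big_seq1 /XH_word /= h1.
have [[Xx|[i _ Hx]]|[y [Xy|[i _ Hy]] <-]] := Ss x (mem_head _ _).
- exact: (Xletter x false).
- exact: Hletter Hx.
- exact: (Xletter y true).
- by apply: (Hletter i); rewrite gpredV.
Qed.

End LetterIntegrals.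

(** * The loop inequality from a linear relative Dehn function *)

Section LinearDehn.
Variables (K : realType) (G : groupType) (m : nat) (H : 'I_m -> groupClosed G).

Lemma relator_val (X : set G) (Rel : set (seq (letter X H))) w :
  finite_rel_presentation Rel -> Rel w -> word_val w = 1.
Proof.
move=> [_ _ _ _ kerE] Rw; rewrite -free_to_groupE.
have : [set x : free_product X H | free_to_group x = 1] (free_class w).
  by rewrite -kerE => P _; apply; exists w.
by [].
Qed.

(** A word trivial in G is a product of linearly many conjugates of relators, and each relator
    contributes a bounded integral. The constant depends on N but not on [psi] or [f]. *)
Lemma rel_loop_inequality : relatively_hyperbolic H K ->
  exists X : set G, [/\ finite_set X, generates (rel_generating_set H X) &
    forall N, exists C, forall psi f, letter_lip X H N psi ->
      letter_lip X H N f ->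
      forall g (w : seq (letter X H)), XH_word w -> word_val w = 1 ->
      (`|word_integral psi f g w| <= (C * size w)%:Z)%R].
Proof.
move=> [X [Rel [finX genX presR [f [[isof _] [L leL]]]]]]; exists X; split=> // N.
have [finR _ _ _ _] := presR.
have [M leM] : exists M, forall r, Rel r -> (size r <= M)%N.
  apply: (finite_uniform_bound finR) => [r k n kn rk|r _]; last by exists (size r).
  exact: leq_trans kn.
have [L0 leL0] : exists L0, forall n, (f n <= L0 * n)%N.
  exists (Num.bound `|L|) => n; rewrite -(ler_nat K) natrM.
  apply: le_trans (leL n) _; apply: ler_wpM2r; first exact: ler0n.
  apply: le_trans (ler_norm L) _.
  by apply/ltW/archi_boundP.
(* [B] is the bound of [word_integral_bound] for a closed word of length at most M, with [c] equal
   to [psi] at the base point. *)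
pose B := (M * N * (M.+1 * N))%N; exists (L0 * B)%N => psi phi lip_psi lip_phi.
move=> g w XHw w1; have [k kf prodk] := isof _ _ XHw (leqnn _) w1.
rewrite -free_integralE.
apply: le_trans (free_integral_conjugate_product (B := B) _ _ g prodk) _.
- by move=> _ [r Rr <-]; rewrite free_to_groupE (relator_val presR).
- move=> _ h [r Rr <-]; rewrite free_integralE.
  have := word_integral_bound lip_psi lip_phi (Posz (psi h)) h r.
  rewrite (relator_val presR Rr) mulg1 !subrr normr0 mulr0 subr0 add0r.
  move=> le_r; apply: le_trans le_r _.
  have := leM r Rr; rewrite -PoszM lez_nat /B => rM.
  by rewrite !leq_mul.
- rewrite lez_nat mulnAC leq_mul2r; apply/orP; right.
  exact: leq_trans kf (leL0 _).
Qed.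

End LinearDehn.

(** * Passing to a subgroup *)

Section LipschitzExtension.
Variables (G : groupType) (X : set G) (m : nat) (H : 'I_m -> groupClosed G).
Variables (R : groupClosed G) (genX : generates (rel_generating_set H X)).

(** The McShane extension: the value at g is the minimum of [phi r] plus N times the length of a
    word leading from g to r. The hypothesis says that [phi] is already N-Lipschitz for the ambient
    relative distance, so its values on R are not lowered. *)
Lemma letter_lip_extension (N : nat) (phi : subgroup_type R -> nat) :
  (forall r s (w : seq (letter X H)), val s = val r * word_val w ->
    (phi r <= phi s + N * size w)%N) ->
  exists2 Phi, letter_lip X H N Phi & forall r, Phi (val r) = phi r.
Proof.
move=> lip_phi.
pose P g n := `[< exists r (w : seq (letter X H)),
  val r = g * word_val w /\ n = (phi r + N * size w)%N >].
have exP g : exists n, P g n.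
  have [w [_ wE]] := letter_word_exists g^-1 genX.
  exists (phi 1%g + N * size w)%N; apply/asboolP; exists 1, w.
  by rewrite wE mulgV.
exists (fun g => ex_minn (exP g)) => [g a|r].
  case: ex_minnP => n _ min_n; case: ex_minnP => k /asboolP[r [w [rE ->]]] _.
  apply: leq_trans (min_n (phi r + N * (size w).+1)%N _) _; last first.
    by rewrite mulnS [(N + _)%N]addnC addnA.
  apply/asboolP; exists r, (letter_inv a :: w); split=> //.
  by rewrite /word_val big_cons letter_val_inv mulgA mulgK.
case: ex_minnP => n /asboolP[s [w [sE ->]]] min_n; apply/eqP.
rewrite eqn_leq lip_phi // andbT; apply: min_n; apply/asboolP.
by exists r, [::]; rewrite /word_val big_nil mulg1 muln0 addn0.
Qed.

(** Lipschitz functions on R extend to G, and a loop in R becomes a loop in G when each step is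
    spelled by a word of bounded length. Each step then changes the integral by a bounded amount. *)
Lemma subgroup_loop_inequality (Y : set (subgroup_type R)) (N : nat) :
  finite_set Y -> generates Y ->
  (forall r (w : seq (letter X H)), val r = word_val w ->
    (word_length Y r <= N * size w)%N) ->
  (forall N, exists C, forall psi f, letter_lip X H N psi ->
      letter_lip X H N f ->
      forall g (w : seq (letter X H)), XH_word w -> word_val w = 1 ->
      (`|word_integral psi f g w| <= (C * size w)%:Z)%R) ->
  exists C, loop_inequality (word_dist Y) C.
Proof.
move=> finY genY leN /(_ N)[C loopC].
have [B leB] : exists B, forall y, sym_set Y y -> exists w : seq (letter X H),
    [/\ XH_word w, word_val w = val y & (size w <= B)%N].
  apply: (finite_uniform_bound (finite_sym_set finY)).
    by move=> y k n kn [w [XHw wy wk]]; exists w; split=> //; exact: leq_trans kn.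
  move=> y _; have [w [XHw wy]] := letter_word_exists (val y) genX.
  by exists (size w), w.
have lipP (phi : subgroup_type R -> nat) : lip1 (word_dist Y) phi ->
    exists2 Phi, letter_lip X H N Phi & forall r, Phi (val r) = phi r.
  move=> lip_phi; apply: letter_lip_extension => r s w rsw.
  apply: leq_trans (lip_phi r s) _; rewrite leq_add2l; apply: leN.
  by rewrite /= rsw mulKg.
(* [D] bounds the error on one step, spelled by at most B letters. The loop in G is at most B times
   longer, whence the constant [C * B + D]. *)
pose D := (B * N * (B.+1 * N))%N.
exists (C * B + D)%N => psi0 f0 /lipP[psi lip_psi psiE] /lipP[f lip_f fE] x p.
move=> xp px.
have [w [XHw wE sz_w le_w]] : exists w : seq (letter X H),
    [/\ XH_word w, word_val w = (val x)^-1 * val (last x p),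
        (size w <= B * size p)%N &
        (integral psi0 f0 x p <=
         word_integral psi f (val x) w + (D * size p)%:Z)%R].
  elim: p x xp {px} => [|y p IHp] x /= xp.
    by exists [::]; rewrite /word_val big_nil mulVg !muln0.
  have /andP[xy yp] := xp; have [w [XHw wE sz_w le_w]] := IHp y yp.
  have [v [XHv vE sz_v]] : exists v : seq (letter X H),
      [/\ XH_word v, word_val v = (val x)^-1 * val y & (size v <= B)%N].
    have [->|/leB//] := word_dist_le1 genY xy.
    by exists [::]; rewrite /word_val big_nil mulVg.
  exists (v ++ w); split.
  - by rewrite /XH_word all_cat; apply/andP.
  - by rewrite word_val_cat vE wE -mulgA mulVKg.
  - by rewrite size_cat mulnS leq_add.
  - rewrite word_integral_cat vE mulVKg.
    have := word_integral_bound lip_psi lip_f (Posz (psi (val x))) (val x) v.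
    rewrite vE mulVKg subrr normr0 add0r !psiE !fE => bv.
    have vD : (size v * N * ((size v).+1 * N) <= D)%N by rewrite !leq_mul.
    have {}bv : (`|word_integral psi f (val x) v -
        (psi0 x)%:Z * ((f0 y)%:Z - (f0 x)%:Z)| <= D%:Z)%R.
      by apply: le_trans bv _; rewrite -PoszM lez_nat.
    rewrite mulnS PoszD; move: bv le_w; rewrite ler_norml => /andP[+ _].
    move: (_ * (_ - _))%R (word_integral _ _ _ v) => e Iv.
    by move: (integral _ _ _ _) (word_integral _ _ _ _) (D * size p)%N; ilia.
have w1 : word_val w = 1 by rewrite wE px mulVg.
have := loopC psi f lip_psi lip_f (val x) w XHw w1; rewrite ler_norml => /andP[_].
have : (C * size w <= C * B * size p)%N by rewrite -mulnA leq_mul2l sz_w orbT.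
rewrite mulnDl PoszD; move: (integral _ _ _ _) (word_integral _ _ _ _) le_w.
by move: (D * _)%N (C * size w)%N (C * B * _)%N; ilia.
Qed.

End LipschitzExtension.

(** * A finite generating set for a strongly quasi-convex subgroup *)

Section QuasiconvexGenerators.
Variables (K : realType) (G : groupType) (X : set G).
Hypotheses (finX : finite_set X) (genX : generates X).
Variables (m : nat) (H : 'I_m -> groupClosed G) (R : groupClosed G).

Lemma finite_ball n : finite_set [set g | (word_length X g <= n)%N].
Proof.
suff fin_n : finite_set [set g | exists2 w, spells X w g & (size w <= n)%N].
  apply: sub_finite_set fin_n => g /= gn.
  by have [w Xw wn] := word_length_spells genX g; exists w; rewrite ?wn.
elim: n => [|n IHn].
  apply: sub_finite_set (finite_set1 1) => g [[|//] [_ <-] _].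
  by rewrite big_nil.
apply: (@sub_finite_set _ _ (1 |` [set s * h | s in sym_set X & h in
    [set g | exists2 w, spells X w g & (size w <= n)%N]])).
  move=> g [[|s w] [Xw <-] /= wn]; first by left; rewrite big_nil.
  right; exists s; first by apply: Xw; rewrite mem_head.
  exists (\prod_(t <- w) t); last by rewrite big_cons.
  by exists w => //; split=> // t tw; apply: Xw; rewrite inE tw orbT.
rewrite finite_setU; split; first exact: finite_set1.
by apply: finite_image2 => //; exact: finite_sym_set.
Qed.

Lemma generates_rel : generates (rel_generating_set H X).
Proof.
move=> g; have [w [Xw <-]] := genX g; exists w; split=> // s /Xw.
by case=> [Xs|[t Xt <-]]; [left; left | right; exists t => //; left].
Qed.

Lemma cayley_path_spells (S : set G) w g x : spells S w g ->
  exists2 p, cayley_path S x (x * g) p & size p = size w.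
Proof.
move=> [+ <-]; elim: w x => [|s w IHw] x Sw.
  by exists [::]; rewrite // big_nil mulg1.
have [|p [xp px] sz_p] := IHw (x * s).
  by move=> t tw; apply: Sw; rewrite inE tw orbT.
exists (x * s :: p); last by rewrite /= sz_p.
split=> /=; last by rewrite px big_cons mulgA.
by rewrite xp andbT; apply/asboolP; rewrite mulKg; apply: Sw; rewrite mem_head.
Qed.

Lemma cayley_geodesic_exists (S : set G) x y p : cayley_path S x y p ->
  exists2 q, cayley_geodesic S x y q & (size q <= size p)%N.
Proof.
move=> xp.
have exn : exists n, `[< exists2 q, cayley_path S x y q & size q = n >].
  by exists (size p); apply/asboolP; exists p.
case: (ex_minnP exn) => n /asboolP[q xq <-] min_n; exists q.
  by split=> // r xr; apply/min_n/asboolP; exists r.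
by apply/min_n/asboolP; exists p.
Qed.

(** If [x] and [x * s] span an edge of the relative Cayley graph and [x * u], [x * s * v] lie in R,
    then [u^-1 * s * v] leads from one of these points of R to the other. *)
Definition near_letters (n : nat) : set (subgroup_type R) :=
  [set r | exists u v s, [/\ (word_length X u <= n)%N,
     (word_length X v <= n)%N, sym_set (rel_generating_set H X) s &
     val r = u^-1 * s * v]].

(* If r0 = u^-1 h0 v lies in R, every r in R of the form u^-1 h v satisfies
   r r0^-1 = (h h0^-1)^u, an element of the finite set R n H_i^u. *)
Lemma finite_near_letters n :
  (forall (i : 'I_m) (g : G),
    finite_set ([set` R] `&` [set h ^ g | h in [set` H i]])) ->
  finite_set (near_letters n).
Proof.
move=> finRH; pose B := [set g | (word_length X g <= n)%N].
have finB : finite_set B by exact: finite_ball.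
pose A (u v : G) (i : 'I_m) := [set` R] `&` [set u^-1 * h * v | h in [set` H i]].
have finA u v i : finite_set (A u v i).
  have [->|/set0P[r0 [Rr0 [h0 Hh0 r0E]]]] := eqVneq (A u v i) set0.
    exact: finite_set0.
  apply: (@sub_finite_set _ _
      [set q * r0 | q in [set` R] `&` [set h ^ u | h in [set` H i]]]).
    move=> r [Rr [h Hh rE]]; exists (r * r0^-1); last by rewrite mulgVK.
    split; first by rewrite /= gpredF.
    exists (h * h0^-1); first by rewrite /= gpredF.
    by rewrite -rE -r0E conjgE !invgM invgK !mulgA mulgK.
  exact: finite_image.
pose AX (u v : G) := [set u^-1 * s * v | s in sym_set X].
have finAX u v : finite_set (AX u v) by apply/finite_image/finite_sym_set.
pose U := \bigcup_(u in B) \bigcup_(v in B)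
  (AX u v `|` \bigcup_(i in [set: 'I_m]) A u v i).
have finU : finite_set U.
  apply: bigcup_finite => // u _; apply: bigcup_finite => // v _.
  by rewrite finite_setU; split=> //; apply: bigcup_finite.
apply: (@sub_finite_set _ _ (val @^-1` U)); last first.
  by apply: finite_preimage finU => r s _ _; exact: val_inj.
move=> r [u [v [s [Bu Bv Ss rE]]]]; exists u => //; exists v => //.
case: Ss => [[Xs|[i _ Hs]]|[t [Xt|[i _ Ht]] ts]].
- by left; exists s; [left | rewrite rE].
- by right; exists i => //; split; [exact: valP | exists s].
- by left; exists s; [right; exists t | rewrite rE].
- right; exists i => //; split; first exact: valP.
  by exists s; rewrite // -ts /= gpredV.
Qed.

(** Along a relative geodesic from 1 to [r], a point of R is chosen near each vertex; consecutive
    choices differ by one near letter, so [r] is a product of no more near letters than the geodesic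
    has edges. *)
Lemma quasiconvex_length : rel_quasiconvex H K X R ->
  exists n, forall (r : subgroup_type R) w,
    spells (rel_generating_set H X) w (val r) ->
    exists2 v, spells (near_letters n) v r & (size v <= size w)%N.
Proof.
move=> [sigma sigma0 qc]; exists (Num.bound sigma) => r w Sw.
have [p xp sz_p] := cayley_path_spells 1 Sw; rewrite mul1g in xp.
have [q [[xq qr] min_q] sz_q] := cayley_geodesic_exists xp.
have R1 : 1 \in R by rewrite gpred1.
have {}qc := qc _ _ R1 (valP r) q (conj (conj xq qr) min_q).
pose good x u := (word_length X u <= Num.bound sigma)%N /\ x * u \in R.
(* Vertices in R are left in place, so that the endpoints 1 and [r] are not moved. *)
pose c x := if x \in R then 1 else xget 1 [set u | good x u].
have c_good x : x \in 1 :: q -> good x (c x).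
  move=> /qc[y Ry dy]; rewrite /c; case: ifP => Rx.
    split; last by rewrite mulg1.
    by rewrite (leq_trans (word_length_le genX (spells_nil X))).
  case: xgetP => [u _ //|/(_ (x^-1 * y))[]]; split; last by rewrite mulVKg.
  rewrite -(ler_nat K); apply: le_trans dy _.
  exact/ltW/archi_boundP/ltW.
have cR x : x \in R -> x * c x = x by rewrite /c => ->; rewrite mulg1.
(* Generalised over the first vertex for the induction on [q]: [s] leads from the point of R chosen
   near the first vertex to the one near the last. *)
have : forall s : subgroup_type R,
    val s = (1 * c 1)^-1 * (last 1 q * c (last 1 q)) ->
    exists2 v, spells (near_letters (Num.bound sigma)) v s & (size v <= size q)%N.
  elim: q 1 xq c_good {qr min_q sz_q qc} => [|y q IHq] x /= xq c_good s sE.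
    exists [::] => //; have -> : s = 1 by apply/val_inj/(etrans sE); rewrite mulVg.
    exact: spells_nil.
  move/andP: xq => [/asboolP xy yq].
  have [cx Rx] : good x (c x) by apply: c_good; rewrite mem_head.
  have [cy Ry] : good y (c y) by apply: c_good; rewrite inE mem_head orbT.
  have Rt : (x * c x)^-1 * (y * c y) \in R by rewrite gpredMl ?gpredV.
  pose t : subgroup_type R := exist (fun x => x \in R) _ Rt.
  have c_good' z : z \in y :: q -> good z (c z).
    by move=> zq; apply: c_good; rewrite inE zq orbT.
  have [|v Sv sz_v] := IHq y yq c_good' (t^-1 * s).
  - rewrite [LHS](_ : _ = (sval t)^-1 * sval s) // sE /=.
    move: (x * c x) (y * c y) (last y q * _) => a b e.
    by rewrite invgM invgK -mulgA mulVKg.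
  - exists (t :: v) => //; rewrite -[s](mulVKg t) -cat1s.
    apply: spells_cat Sv; apply: spells1; left.
    exists (c x), (c y), (x^-1 * y); split=> //.
    by rewrite /= invgM !mulgA.
move=> /(_ r); rewrite qr !cR ?gpred1 ?(valP r) // invg1 mul1g => /(_ erefl).
by move=> [v Sv vq]; exists v; rewrite // -sz_p (leq_trans vq).
Qed.

(** The relative presentation has its own generators, while quasi-convexity refers to [X]. Letters
    from the H_i belong to both relative generating sets, so only the finitely many elements of [X']
    have to be rewritten. *)
Lemma letter_word_spells (X' : set G) : finite_set X' ->
  exists N, forall w : seq (letter X' H),
    exists2 v, spells (rel_generating_set H X) v (word_val w) &
      (size v <= N * size w)%N.
Proof.
move=> finX'; pose S := rel_generating_set H X.
have [N leN] : exists N, forall x, X' x ->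
    exists2 v, spells S v x & (size v <= N)%N.
  apply: (finite_uniform_bound finX') => [x k n kn [v Sv vk]|x _].
    by exists v; rewrite // (leq_trans vk).
  by have [v Sv] := generates_rel x; exists (size v), v.
have letterN (a : letter X' H) :
    exists2 v, spells S v (letter_val a) & (size v <= N.+1)%N.
  case: a => [[x e]|[i h]] /=; last first.
    exists [:: \val h] => //; apply: spells1; left; right.
    by exists i; last exact: valP.
  have [v Sv vN] := leN _ (set_valP x); case: e; last by exists v; rewrite // ltnW.
  exists (rev (map (fun s => s^-1) v)); first exact: spellsV.
  by rewrite size_rev size_map ltnW.
exists N.+1; elim=> [|a w [v Sv sz_v]].
  by exists [::]; rewrite // /word_val big_nil; exact: spells_nil.
have [u Su sz_u] := letterN a; exists (u ++ v).
  by rewrite /word_val big_cons; exact: spells_cat.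
by rewrite size_cat mulnS leq_add.
Qed.

End QuasiconvexGenerators.

Theorem theorem1p10 (K : realType) (G : groupType) (X : set G)
    (X_finite : finite_set X) (X_generates : generates X)
    (m : nat) (H : 'I_m -> groupClosed G) (R : groupClosed G) :
  relatively_hyperbolic H K ->
  strongly_rel_quasiconvex H K X R ->
  hyperbolic_group K (subgroup_type R).
Proof.
move=> /rel_loop_inequality[X' [finX' genX' loopX']] [qcR finRH].
have [n leY] := quasiconvex_length X_generates qcR.
pose Y : set (subgroup_type R) := near_letters X H n.
have genY : generates Y.
  move=> r; have [w Sw] := generates_rel X_generates H (val r).
  by have [v Yv _] := leY r w Sw; exists v.
have finY : finite_set Y by exact: finite_near_letters.
have [N leN] := letter_word_spells X_generates H finX'.
(* R is undistorted: its word length is linearly bounded by the relative length of the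
   presentation. *)
have lenY (r : subgroup_type R) (w : seq (letter X' H)) :
    val r = word_val w -> (word_length Y r <= N * size w)%N.
  move=> rE; have [v Sv sz_v] := leN w; rewrite -rE in Sv.
  have [u Yu sz_u] := leY r v Sv.
  exact: leq_trans (word_length_le genY Yu) (leq_trans sz_u sz_v).
have [C loopY] := subgroup_loop_inequality genX' finY genY lenY loopX'.
have [E four] := four_points (discrete_metric_word_dist genY) loopY.
exists Y; split=> //; exact: four_points_hyperbolic four.
Qed.
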